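(* Let $P=K[X]$ be endowed with $\sigma$ and a weight function $\mathrm{w}$ as in the context, and let $S=P[s;\sigma]$ be endowed with a monomial ordering. Let $I\subsetneq P$ be a $\mathrm{w}$-graded $\Sigma$-invariant ideal, and let $G=\bigcup_{i\ge0} G_i$, $G_i\subset I_i$, be a $\mathrm{w}$-homogeneous Gröbner $\Sigma$-basis of $I$. Then $G^S=\{fs^i\mid f\in G_i,\ i\geq0\}$ is an $s$-homogeneous Gröbner basis of the skew analogue $I^S$.
   Context: $K$ is a field, $X=\{x_0,x_1,\ldots\}$ a countable set of variables, $P=K[X]$ the commutative polynomial ring, $\mathrm{Mon}(P)$ its set of monomials (including 1). $\sigma:P\to P$ is an injective $K$-algebra endomorphism of infinite order mapping monomials to monomials, with $\gcd(\sigma(x_i),\sigma(x_j))=1$ for $i\neq j$. $S=P[s;\sigma]$ is the free left $P$-module with basis $\Sigma=\{s^i\}_{i\ge0}$ and multiplication determined by $sf=\sigma(f)s$; it is graded by $S_i=Ps^i$, whose elements are called $s$-homogeneous. $\mathrm{Mon}(S)=\{ms^i\mid m\in\mathrm{Mon}(P),i\ge0\}$. $S$ is endowed with a monomial ordering $\prec$: a total well-ordering of $\mathrm{Mon}(S)$ with $v\prec w\Rightarrow pvq\prec pwq$ for all $v,w,p,q\in\mathrm{Mon}(S)$; its restriction is used on $P$ (one then has $m\prec n\Rightarrow\sigma(m)\prec\sigma(n)$ on $\mathrm{Mon}(P)$). $\mathrm{lm}(f)$ is the largest monomial occurring in $f\ne0$, and $\mathrm{lm}(G)=\{\mathrm{lm}(f)\mid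 f\in G, f\ne0\}$. $\Sigma$ acts on $P$ by $s^i\cdot f=\sigma^i(f)$; an ideal $I\subset P$ is $\Sigma$-invariant if $\sigma(I)\subset I$. A subset $G\subset I$ is a Gröbner $\Sigma$-basis of $I$ if $\Sigma\cdot G=\{\sigma^i(g)\mid g\in G,i\ge0\}$ is a Gröbner basis of the ideal $I$ of $P$, i.e. $\mathrm{lm}(\Sigma\cdot G)$ and $\mathrm{lm}(I)$ generate the same ideal of $P$. A subset $G$ of a two-sided ideal $J\subset S$ is a Gröbner basis of $J$ if $\mathrm{lm}(G)$ and $\mathrm{lm}(J)$ generate the same two-sided ideal of $S$. Weights: $\hat{\mathbb{N}}=\{-\infty\}\cup\mathbb{N}$, with $\max(-\infty,x)=x$ and $-\infty+x=-\infty$. A weight function is a map $\mathrm{w}:\mathrm{Mon}(P)\to\hat{\mathbb{N}}$ with $\mathrm{w}(1)=-\infty$, $\mathrm{w}(x_i)\in\mathbb{N}$ for every variable, $\mathrm{w}(mn)=\max(\mathrm{w}(m),\mathrm{w}(n))$, $\mathrm{w}(\sigma(x_i))=1+\mathrm{w}(x_i)$. $P_i$ is the $K$-span of the monomials of weight $i$ (its elements are $\mathrm{w}$-homogeneous), so $P=\bigoplus_{i\in\hat{\mathbb{N}}}P_i$, $P_{-\infty}=K$. An ideal $I$ is $\mathrm{w}$-graded if $I=\sum_iI_i$ with $I_i=I\cap P_i$. For a $\mathrm{w}$-graded $\Sigma$-invariant ideal $I\subsetneq P$, its skew analogue $I^S$ is the two-sided ideal of $S$ generated by $\{fs^i\mid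 f\in I_i,i\ge0\}$. *)

(* Defs.v *)
From HB Require Import structures.
From mathcomp Require Import all_boot all_order all_algebra.
From mathcomp Require Import finmap.
From mathcomp Require Import monalg.
From mathcomp Require Import boolp classical_sets.

Set Implicit Arguments.
Unset Strict Implicit.
Unset Printing Implicit Defensive.

Import GRing.Theory.

Local Open Scope classical_set_scope.
Local Open Scope ring_scope.

(* Two-sided ideals; additive inverses come from a = -1. *)
Definition is_ideal (R : nzRingType) (J : set R) : Prop :=
  [/\ J 0,
      forall x y, J x -> J y -> J (x + y) &
      forall a x b, J x -> J (a * x * b)].

Definition ideal_gen (R : nzRingType) (A : set R) : set R :=
  [set x | forall J : set R, is_ideal J -> A `<=` J -> J x].

(* The skew polynomial ring R[s; sigma]: the left R-module of {poly R}, with *)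
(* basis the powers s^i = 'X^i, and the product determined by                *)
(* s f = sigma(f) s.                                                         *)
Definition skewpoly (R : nzRingType) (sigma : {rmorphism R -> R}) : Type :=
  {poly R}.

Section SkewPoly.

Variables (R : nzRingType) (sigma : {rmorphism R -> R}).

Local Notation S := (skewpoly sigma).

HB.instance Definition _ := GRing.Lmodule.copy S {poly R}.

Definition skew_coef (p : S) (i : nat) : R := (p : {poly R})`_i.

Definition skew_mul (p q : S) : S :=
  \poly_(k < (size (p : {poly R}) + size (q : {poly R})).-1)
    \sum_(i < k.+1) skew_coef p i * iter i sigma (skew_coef q (k - i)).

(* The element f s^i of R[s; sigma]. *)
Definition skew_term (f : R) (i : nat) : S := (f *: 'X^i : {poly R}).

Lemma iter_rmorph0 i : iter i sigma 0 = 0.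
Proof. by elim: i => //= i ->; rewrite rmorph0. Qed.

Lemma iter_rmorph1 i : iter i sigma 1 = 1.
Proof. by elim: i => //= i ->; rewrite rmorph1. Qed.

Lemma iter_rmorphD i : {morph iter i sigma : x y / x + y}.
Proof. by move=> x y; elim: i => //= i ->; rewrite rmorphD. Qed.

Lemma iter_rmorphM i : {morph iter i sigma : x y / x * y}.
Proof. by move=> x y; elim: i => //= i ->; rewrite rmorphM. Qed.

Lemma iter_rmorph_sum i (I : Type) (r : seq I) (P : pred I) (F : I -> R) :
  iter i sigma (\sum_(j <- r | P j) F j)
  = \sum_(j <- r | P j) iter i sigma (F j).
Proof. exact: (big_morph _ (iter_rmorphD i) (iter_rmorph0 i)). Qed.

Lemma skew_coefP (p q : S) : skew_coef p =1 skew_coef q -> p = q.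
Proof. by move=> pq; exact: (proj1 (@polyP R p q) pq). Qed.

Lemma skew_coefD (p q : S) i :
  skew_coef (p + q) i = skew_coef p i + skew_coef q i.
Proof. exact: coefD. Qed.

Lemma skew_coef_term f i j : skew_coef (skew_term f i) j = f *+ (j == i).
Proof. by rewrite /skew_coef coefZ coefXn mulr_natr. Qed.

Lemma skew_coefM (p q : S) k :
  skew_coef (skew_mul p q) k
  = \sum_(i < k.+1) skew_coef p i * iter i sigma (skew_coef q (k - i)).
Proof.
rewrite /skew_coef coef_poly ltn_predRL; case: leqP => // le_pq_i1.
rewrite big1 // => j _; have [lq_p_j|lt_j_p] := leqP (size (p : {poly R})) j.
  by rewrite nth_default ?mul0r.
rewrite [(q : {poly R})`__]nth_default ?iter_rmorph0 ?mulr0 //.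
rewrite leq_subRL -ltnS //.
by rewrite (leq_trans _ le_pq_i1) // ltn_add2r.
Qed.

Lemma skew_coefM_rev (p q : S) k :
  skew_coef (skew_mul p q) k
  = \sum_(i < k.+1) skew_coef p (k - i) * iter (k - i) sigma (skew_coef q i).
Proof.
rewrite skew_coefM (reindex_inj rev_ord_inj) /=.
by apply: eq_bigr => j _; rewrite (sub_ordK j).
Qed.

Lemma skew_mulA : associative skew_mul.
Proof.
move=> p q r; apply: skew_coefP => i; rewrite skew_coefM skew_coefM_rev.
pose coef3 j k := skew_coef p j * (iter j sigma (skew_coef q (i - j - k))
  * iter (i - k) sigma (skew_coef r k)).
transitivity (\sum_(j < i.+1) \sum_(k < i.+1 | (k <= i - j)%N) coef3 j k).
  apply: eq_bigr => /= j _.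
  rewrite skew_coefM_rev iter_rmorph_sum big_distrr /=.
  rewrite (big_ord_narrow_leq (leq_subr _ _)); apply: eq_bigr => k _ /=.
  rewrite /coef3 iter_rmorphM -iterD subnAC subnKC //.
  have kij : (k <= i - j)%N by rewrite -ltnS.
  have ji : (j <= i)%N by rewrite -ltnS.
  by rewrite leq_subRL ?(leq_trans kij) ?leq_subr // addnC -leq_subRL.
rewrite (exchange_big_dep predT) //=; apply: eq_bigr => k _.
transitivity (\sum_(j < i.+1 | (j <= i - k)%N) coef3 j k).
  apply: eq_bigl => j; rewrite -ltnS -(ltnS j) -!subSn ?leq_ord //.
  by rewrite -subn_gt0 -(subn_gt0 j) -!subnDA addnC.
rewrite (big_ord_narrow_leq (leq_subr _ _)) skew_coefM big_distrl /=.
by apply: eq_bigr => j _; rewrite /coef3 -!subnDA addnC mulrA.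
Qed.

Lemma skew_mul1 : left_id (skew_term 1 0) skew_mul.
Proof.
move=> p; apply: skew_coefP => i; rewrite skew_coefM big_ord_recl subn0.
rewrite big1 => [|j _]; rewrite skew_coef_term ?mul0r //.
by rewrite mul1r addr0.
Qed.

Lemma skew_mulr1 : right_id (skew_term 1 0) skew_mul.
Proof.
move=> p; apply: skew_coefP => i; rewrite skew_coefM_rev big_ord_recl subn0.
rewrite big1 => [|j _]; rewrite skew_coef_term ?iter_rmorph0 ?mulr0 //.
by rewrite iter_rmorph1 mulr1 addr0.
Qed.

Lemma skew_mulDl : left_distributive skew_mul +%R.
Proof.
move=> p q r; apply: skew_coefP => i.
rewrite skew_coefD !skew_coefM -big_split.
by apply: eq_bigr => j _; rewrite skew_coefD mulrDl.
Qed.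

Lemma skew_mulDr : right_distributive skew_mul +%R.
Proof.
move=> p q r; apply: skew_coefP => i.
rewrite skew_coefD !skew_coefM -big_split.
by apply: eq_bigr => j _; rewrite skew_coefD iter_rmorphD mulrDr.
Qed.

Lemma skew_oner_neq0 : skew_term 1 0 != 0.
Proof. by rewrite /skew_term expr0 scale1r oner_neq0. Qed.

HB.instance Definition _ := GRing.Zmodule_isNzRing.Build S
  skew_mulA skew_mul1 skew_mulr1 skew_mulDl skew_mulDr skew_oner_neq0.

Lemma skew_termM f g i j :
  skew_term f i * skew_term g j = skew_term (f * iter i sigma g) (i + j).
Proof.
apply: skew_coefP => k; rewrite skew_coefM skew_coef_term.
have [->|nk] := eqVneq k (i + j)%N.
  have ik : (i < (i + j).+1)%N by rewrite ltnS leq_addr.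
  rewrite (bigD1 (Ordinal ik)) //= !skew_coef_term eqxx addKn eqxx big1 ?addr0 //.
  move=> l; rewrite -val_eqE /= => /negPf nl.
  by rewrite skew_coef_term nl mul0r.
rewrite big1 // => l _; rewrite !skew_coef_term.
case: eqP => [li|_]; last by rewrite mul0r.
case: eqP => [kl|_]; last by rewrite iter_rmorph0 mulr0.
by case/eqP: nk; rewrite -kl -li subnKC // -ltnS.
Qed.

End SkewPoly.

(* The polynomial ring K[x_0, x_1, ...]; {cmonom nat} is the free commutative *)
(* monoid on the variables, and << m >> is the monomial m viewed as a         *)
(* polynomial.                                                                *)
Notation polyring K := {malg K[{cmonom nat}]}.

Definition xvar (K : fieldType) (i : nat) : polyring K := << ucm i >>.

Section Sigma.

Variables (K : fieldType) (sigma : {lrmorphism polyring K -> polyring K}).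

(* The last clause says that gcd(sigma x_i, sigma x_j) = 1 in K[X]. *)
Record monomial_endo : Prop := MonomialEndo {
  endo_inj : injective sigma;
  endo_order : forall n, (0 < n)%N -> exists f, iter n sigma f <> f;
  endo_monom : forall m : {cmonom nat}, exists n, sigma << m >> = << n >>;
  endo_coprime : forall i j, i <> j -> forall d a b : polyring K,
    sigma (xvar K i) = a * d -> sigma (xvar K j) = b * d ->
    exists c, c * d = 1
}.

(* Mon(S): the pair (m, i) stands for the monomial m s^i. *)
Definition smonom : Type := ({cmonom nat} * nat)%type.

Definition of_smonom (u : smonom) : skewpoly sigma :=
  skew_term sigma << u.1 >> u.2.

(* In the last clause v' and w' are the monomials p v q and p w q. *)
Record monomial_ordering (lt : smonom -> smonom -> Prop) : Prop :=
  MonomialOrdering {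
  mo_trans : forall u v w, lt u v -> lt v w -> lt u w;
  mo_total : forall u v, [\/ lt u v, u = v | lt v u];
  mo_wf : well_founded lt;
  mo_mul : forall v w p q v' w', lt v w ->
    of_smonom v' = of_smonom p * of_smonom v * of_smonom q ->
    of_smonom w' = of_smonom p * of_smonom w * of_smonom q ->
    lt v' w'
}.

(* Weights live in {-oo} U nat, represented as option nat with None for -oo. *)
Definition wmax (a b : option nat) : option nat :=
  match a, b with
  | None, _ => b
  | _, None => a
  | Some i, Some j => Some (maxn i j)
  end.

Record weight_function (w : {cmonom nat} -> option nat) : Prop :=
  WeightFunction {
  weight1 : w mone = None;
  weight_var : forall i, exists k, w (ucm i) = Some k;
  weightM : forall m n, w (mmul m n) = wmax (w m) (w n);
  weight_sigma : forall i m, sigma (xvar K i) = << m >> ->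
    w m = omap (addn 1) (w (ucm i))
}.

(* The component P_a: the K-span of the monomials of weight a. *)
Definition wcomp (w : {cmonom nat} -> option nat) (a : option nat) :
  set (polyring K) := [set f | forall m, m \in msupp f -> w m = a].

Definition wgraded (w : {cmonom nat} -> option nat) (I : set (polyring K)) :
  Prop :=
  forall f, I f -> exists r : seq (polyring K),
    (forall g, g \in r -> exists a, (I `&` wcomp w a) g)
    /\ f = \sum_(g <- r) g.

Definition sigma_invariant (I : set (polyring K)) : Prop := sigma @` I `<=` I.

Definition sigma_orbit (G : set (polyring K)) : set (polyring K) :=
  [set f | exists i, exists2 g, G g & f = iter i sigma g].

Section Groebner.

Variable lt : smonom -> smonom -> Prop.

(* m is the leading monomial of f for the restriction of lt to Mon(P); this *)
(* is never the case when f = 0.                                            *)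
Definition is_lm (f : polyring K) (m : {cmonom nat}) : Prop :=
  m \in msupp f
  /\ forall n, n \in msupp f -> n <> m -> lt (n, 0%N) (m, 0%N).

Definition lm_set (G : set (polyring K)) : set (polyring K) :=
  [set h | exists f m, [/\ G f, is_lm f m & h = << m >>]].

Definition groebner_sigma_basis (G I : set (polyring K)) : Prop :=
  G `<=` I
  /\ ideal_gen (lm_set (sigma_orbit G)) = ideal_gen (lm_set I).

Definition ssupp (f : skewpoly sigma) : set smonom :=
  [set u | u.1 \in msupp (skew_coef f u.2)].

Definition is_slm (f : skewpoly sigma) (u : smonom) : Prop :=
  ssupp f u /\ forall v, ssupp f v -> v <> u -> lt v u.

Definition slm_set (G : set (skewpoly sigma)) : set (skewpoly sigma) :=
  [set h | exists f u, [/\ G f, is_slm f u & h = of_smonom u]].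

Definition groebner_basis (G J : set (skewpoly sigma)) : Prop :=
  G `<=` J /\ ideal_gen (slm_set G) = ideal_gen (slm_set J).

End Groebner.

Definition shomogeneous (f : skewpoly sigma) : Prop :=
  exists i h, f = skew_term sigma h i.

(* The set of all f s^i with f in G_i. *)
Definition skew_family (G : nat -> set (polyring K)) : set (skewpoly sigma) :=
  [set h | exists i, exists2 f, G i f & h = skew_term sigma f i].

Definition skew_analogue (w : {cmonom nat} -> option nat)
  (I : set (polyring K)) : set (skewpoly sigma) :=
  ideal_gen (skew_family (fun i => I `&` wcomp w (Some i))).

End Sigma.

Arguments skew_family {K} sigma G _.
Arguments skew_analogue {K} sigma w I _.

(* Main.v *)
(* Write [A n] for the ideal of [P] generated by the [I_j] with [j <= n]. Since
   [sigma (A n)] lies in [A n.+1], the coefficient of [s^n] of an element of the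
   skew analogue lies in [A n]. Let [m s^n] be the leading monomial of such an
   element and factor [m = lo * hi], where [lo] collects the variables of weight
   at most [n]. The generators of [A n] involve only these variables, so the
   coordinate at [hi] of the coefficient of [s^n] still belongs to [I], and its
   leading monomial is [lo]. As [G] is a Groebner Sigma-basis, [lo] is a multiple
   of [lm (sigma^k g) = sigma^k (lm g)] with [g] in some [G i], and comparing
   weights gives [k + i <= n]. Hence [m s^n] is a multiple of
   [s^k (lm g) s^i s^(n - k - i)], that is, of [lm (g s^i)]. *)

Require Import Defs.
From HB Require Import structures.
From mathcomp Require Import all_boot all_order all_algebra.
From mathcomp Require Import finmap.
From mathcomp Require Import monalg.
From mathcomp Require Import boolp classical_sets.

Set Implicit Arguments.
Unset Strict Implicit.
Unset Printing Implicit Defensive.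

Import GRing.Theory.

Local Open Scope classical_set_scope.
Local Open Scope ring_scope.

Local Notation "m *m n" := (mmul m n).

(** * Ideals generated by a set *)

Section Ideals.

Variable R : nzRingType.
Implicit Types (A J : set R).

Lemma ideal_gen_is_ideal A : is_ideal (ideal_gen A).
Proof.
split=> [J|x y Ax Ay J hJ AJ|a x b Ax J hJ AJ]; first by case.
  by case: (hJ) => _ JD _; apply: JD; [exact: Ax|exact: Ay].
by case: (hJ) => _ _; apply; exact: Ax.
Qed.

Lemma sub_ideal_gen A : A `<=` ideal_gen A.
Proof. by move=> x Ax J _; exact. Qed.

Lemma ideal_gen_min A J : is_ideal J -> A `<=` J -> ideal_gen A `<=` J.
Proof. by move=> hJ AJ x; exact. Qed.

Lemma ideal_genS A B : A `<=` B -> ideal_gen A `<=` ideal_gen B.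
Proof.
move=> AB; apply: ideal_gen_min; first exact: ideal_gen_is_ideal.
exact: subset_trans (@sub_ideal_gen B).
Qed.

Lemma ideal_sum J (T : Type) (r : seq T) (P : pred T) (F : T -> R) :
  is_ideal J -> (forall i, P i -> J (F i)) -> J (\sum_(i <- r | P i) F i).
Proof. by case=> J0 JD _; exact: big_ind. Qed.

Lemma idealMl J a x : is_ideal J -> J x -> J (a * x).
Proof. by case=> _ _ JM Jx; rewrite -[_ * x]mulr1; exact: JM. Qed.

Lemma idealMr J x b : is_ideal J -> J x -> J (x * b).
Proof. by case=> _ _ JM Jx; rewrite -[x]mul1r; exact: JM. Qed.

End Ideals.

(** In [a * x], the twist by the [j]-th iterate of [sigma] lifts the coefficient of index [i - j] to
    level [i]. Right multiplication twists only the coefficients of [b], and the levels are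
    increasing. *)
Lemma skew_filtration_ideal (R : nzRingType) (sigma : {rmorphism R -> R})
    (A : nat -> set R) :
  (forall n, is_ideal (A n)) -> (forall n, A n `<=` A n.+1) ->
  (forall n f, A n f -> A n.+1 (sigma f)) ->
  is_ideal [set h : skewpoly sigma | forall n, A n (skew_coef h n)].
Proof.
move=> hA AS Asigma.
have A0 n : A n 0 by case: (hA n).
have Ale i n : (i <= n)%N -> A i `<=` A n.
  move=> /subnK <-; elim: (n - i)%N => //= d IHd.
  by apply: subset_trans IHd _; exact: AS.
have Aiter i n f : A n f -> A (i + n)%N (iter i sigma f).
  by move=> Af; elim: i => //= i; exact: Asigma.
split=> [n|x y Ax Ay n|a x b Ax n] /=.
- by rewrite /skew_coef coef0.
- by rewrite skew_coefD; case: (hA n) => _ AD _; exact: AD.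
rewrite [_ * b]/GRing.mul /= skew_coefM; apply: ideal_sum => // i _.
apply: idealMr => //; apply: (@Ale i); first by rewrite -ltnS.
rewrite [a * _]/GRing.mul /= skew_coefM; apply: ideal_sum => // j _.
apply: idealMl => //.
by have := Aiter j _ _ (Ax (i - j)%N); rewrite subnKC // -ltnS.
Qed.

(** * Monomials and their splitting along a set of variables *)

Section Monomials.

Implicit Types (m n u : {cmonom nat}).

Lemma cmonom_mulI m : injective (mmul m).
Proof.
move=> n n' /eqP/cmP e; apply/eqP/cmP => i.
by move: (e i); rewrite !cmM => /addnI.
Qed.

Lemma cmonom_factor m i : m i != 0%N -> exists n, m = ucm i *m n.
Proof.
move=> mi; exists (divcm m (ucm i)); apply/eqP/cmP => j.
rewrite cmM divcmE ucmE; case: eqP => [<-|_] /=; last by rewrite subn0.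
by rewrite subnKC // lt0n.
Qed.

(** Weights are prescribed on variables and products, so their properties are proved by adding one
    variable at a time. *)
Lemma cmonom_ind (P : {cmonom nat} -> Prop) :
  P mone -> (forall i m, P m -> P (ucm i *m m)) -> forall m, P m.
Proof.
move=> P1 PM m; have [d] := ubnP (mdeg m); elim: d m => // d IHd m md.
have [->//|m1] := eqVneq m mone.
have [i /cmonom_factor [n mE]] : exists i, m i != 0%N.
  apply: contrapT => m0; case/eqP: m1; apply/eqP/cmP => i; rewrite cm1.
  by apply/eqP; apply: contrapT => /negP mi; apply: m0; exists i.
rewrite mE; apply/PM/IHd; move: md; rewrite mE mdegM mdegU.
by rewrite add1n.
Qed.

Definition mrestr (B : pred nat) m : {cmonom nat} :=
  mkcmonom [fsfun i in finsupp m => if B i then m i else 0%N | 0%N]%fset.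

Lemma mrestrE B m i : mrestr B m i = if B i then m i else 0%N.
Proof. by rewrite cmE fsfun_fun; case: finsuppP => // _; case: ifP. Qed.

Lemma mrestrM B : {morph mrestr B : m n / m *m n}.
Proof.
move=> m n; apply/eqP/cmP => i; rewrite cmM !mrestrE cmM; by case: (B i).
Qed.

Lemma mrestrU B i : mrestr B (ucm i) = if B i then ucm i else mone.
Proof.
apply/eqP/cmP => j; rewrite mrestrE ucmE.
case: (eqVneq i j) => [<-|ij]; case: (B i); rewrite ?ucmE ?cm1 ?eqxx //.
  by case: (B j); rewrite (negPf ij).
by case: (B j).
Qed.

Lemma mrestr1 B : mrestr B mone = mone.
Proof. by apply/eqP/cmP => j; rewrite mrestrE cm1 if_same. Qed.

Lemma mrestrK B m : mrestr B m *m mrestr (predC B) m = m.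
Proof.
by apply/eqP/cmP => i; rewrite cmM !mrestrE /=; case: (B i); rewrite //= addn0.
Qed.

End Monomials.

(* [pterm] and [slice] are locked because unification otherwise compares two
   polynomials by unfolding the finitely supported functions underneath. *)
HB.lock Definition pterm (K : fieldType) (c : K) (m : {cmonom nat}) :
    polyring K :=
  << c *g m >>.

(* With B selecting the low variables, K[X] is a free module over K[low], with
   the monomials in the other variables as basis; [slice B u f] is the
   coordinate of [f] at the basis element [u]. *)

HB.lock Definition slice (K : fieldType) (B : pred nat) (u : {cmonom nat})
    (f : polyring K) : polyring K :=
  mmap (@malgC _ K)
    (fun m => if mrestr (predC B) m == u then pterm 1 (mrestr B m) else 0) f.

(** * Coordinates over the low variables, and monomial ideals *)

Section Malg.

Variable K : fieldType.
Implicit Types (f g : polyring K) (m n u : {cmonom nat}).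

Local Notation mon := (pterm (1 : K)).

Lemma ptermE (c : K) m : pterm c m = << c *g m >> :> polyring K.
Proof. by rewrite unlock. Qed.

Lemma ptermM (a b : K) m n : pterm a m * pterm b n = pterm (a * b) (m *m n).
Proof. by rewrite !ptermE malgM_def fgmulUU. Qed.

Lemma mcoeff_pterm (c : K) m n : (pterm c m)@_n = c *+ (m == n).
Proof. by rewrite ptermE mcoeffU. Qed.

Lemma msupp_mon m : msupp (mon m) = [fset m]%fset.
Proof. by rewrite ptermE msuppU1. Qed.

Lemma pterm_expand f : f = \sum_(m <- msupp f) pterm f@_m m.
Proof.
by rewrite {1}[f]monalgE; apply: eq_bigr => m _; rewrite ptermE.
Qed.

Lemma mon_inj : injective mon.
Proof.
move=> m n mn; apply: contrapT => /eqP nm; have := mcoeff_pterm 1 m n.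
by rewrite mn mcoeff_pterm eqxx (negPf nm) => /eqP; rewrite oner_eq0.
Qed.

Lemma sliceD B u : {morph @slice K B u : f g / f + g}.
Proof. by move=> f g; rewrite unlock mmapD. Qed.

Lemma slice0 B u : @slice K B u 0 = 0.
Proof. by rewrite unlock mmap0. Qed.

Lemma slice_sum B u (T : Type) (r : seq T) (F : T -> polyring K) :
  slice B u (\sum_(i <- r) F i) = \sum_(i <- r) slice B u (F i).
Proof. by apply: (big_morph _ (sliceD B u)); exact: slice0. Qed.

Lemma sliceU B u (c : K) m :
  slice B u (pterm c m)
  = if mrestr (predC B) m == u then pterm c (mrestr B m) else 0.
Proof.
rewrite {1}ptermE unlock mmapU; case: eqP => _; last by rewrite mulr0.
by rewrite !ptermE malgM_def fgmulUU mulr1 mul1m.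
Qed.

(** Multiplication by a term shifts the index by the high part of [m]. The shift is injective, so no
    other coordinate of [f] contributes. *)
Lemma slice_ptermM B (c : K) m v f :
  slice B (mrestr (predC B) m *m v) (pterm c m * f)
  = pterm c (mrestr B m) * slice B v f.
Proof.
rewrite [f in LHS]pterm_expand [f in RHS]pterm_expand.
rewrite [in LHS]mulr_sumr 2!slice_sum [in RHS]mulr_sumr.
apply: eq_bigr => k _; rewrite [in LHS]ptermM 2!sliceU 2!mrestrM.
rewrite (inj_eq (@cmonom_mulI _)); case: eqP => _; last by rewrite mulr0.
by rewrite ptermM.
Qed.

Lemma slice_ptermM0 B (c : K) m u f :
  (forall v, u <> mrestr (predC B) m *m v) -> slice B u (pterm c m * f) = 0.
Proof.
move=> um; rewrite [f in LHS]pterm_expand mulr_sumr slice_sum big1 // => k _.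
by rewrite ptermM sliceU mrestrM; case: eqP => // /esym/um.
Qed.

(** Each coordinate of a term times [f] is 0 or a term times a coordinate of [f]. Hence a claim on
    the coordinates of all members of an ideal need only be checked on generators. *)
Lemma slice_ideal B (I : set (polyring K)) :
  is_ideal I -> is_ideal [set f | forall u, I (slice B u f)].
Proof.
move=> hI; case: (hI) => I0 ID _; split => [u|f g hf hg u|a f b hf u] /=.
- by rewrite slice0.
- by rewrite sliceD; exact: ID.
(* By commutativity both multipliers merge into one, which is expanded into terms. *)
rewrite mulrAC [a * b]pterm_expand mulr_suml slice_sum.
apply: ideal_sum => // k _.
have [[v ->]|nv] := pselect (exists v, u = mrestr (predC B) k *m v).
  by rewrite slice_ptermM; exact: idealMl.
by rewrite slice_ptermM0 // => v uv; apply: nv; exists v.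
Qed.

Lemma mem_slice B u f n : n \in msupp (slice B u f) ->
  exists2 m, m \in msupp f & mrestr (predC B) m = u /\ mrestr B m = n.
Proof.
rewrite -mcoeff_neq0 => nf; apply: contrapT => h; case/eqP: nf.
rewrite [f in LHS]pterm_expand slice_sum raddf_sum big_seq big1 //= => m mf.
rewrite sliceU; case: eqP => [mu|_]; last by rewrite mcoeff0.
by rewrite mcoeff_pterm; case: eqP => // mn; case: h; exists m.
Qed.

(** The low and high parts determine a monomial, so nothing cancels the contribution of [m]. *)
Lemma mem_slice_restr B f m : m \in msupp f ->
  mrestr B m \in msupp (slice B (mrestr (predC B) m) f).
Proof.
move=> mf; rewrite -mcoeff_neq0.
rewrite [f in slice _ _ f]pterm_expand slice_sum raddf_sum /=.
rewrite (big_fsetD1 m) //= big1_fset.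
  by rewrite addr0 sliceU eqxx mcoeff_pterm eqxx mulr1n mcoeff_neq0.
move=> k; rewrite in_fsetD1 => /andP[km _] _; rewrite sliceU.
case: eqP => [ku|_]; last by rewrite mcoeff0.
rewrite mcoeff_pterm; case: eqP => // km'; case/eqP: km.
by rewrite -(mrestrK B k) ku km' mrestrK.
Qed.

Lemma slice_id B f : (forall m, m \in msupp f -> mrestr B m = m) ->
  forall u, slice B u f = if mone == u then f else 0.
Proof.
move=> hf u; rewrite [f in LHS]pterm_expand slice_sum.
have hi m : m \in msupp f -> mrestr (predC B) m = mone.
  move=> /hf mB; apply: (@cmonom_mulI (mrestr B m)).
  by rewrite mrestrK mB mulm1.
case: eqP => [<-|u1].
  rewrite [RHS]pterm_expand !big_seq; apply: eq_bigr => m mf.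
  by rewrite sliceU hi // hf // eqxx.
by rewrite big_seq big1 // => m mf; rewrite sliceU hi //; case: eqP.
Qed.

(** The polynomials all of whose monomials are multiples of members of [L] form an ideal containing
    [L]. *)
Lemma monomial_ideal_mem (L : set (polyring K)) m :
  (forall h, L h -> exists n, h = mon n) -> ideal_gen L (mon m) ->
  exists2 n, L (mon n) & exists q, m = q *m n.
Proof.
move=> Lm.
pose J := [set f : polyring K | forall m, m \in msupp f ->
  exists2 n, L (mon n) & exists q, m = q *m n].
suff /[apply] : ideal_gen L `<=` J.
  by apply; rewrite -mcoeff_neq0 mcoeff_pterm eqxx oner_eq0.
apply: ideal_gen_min.
  split=> [k|f g hf hg k|a f b hf k].
  - by rewrite msupp0.
  - move=> /(fsubsetP (msuppD_le _ _)); rewrite in_fsetU.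
    by case/orP => [/hf|/hg].
  rewrite mulrAC => /msuppM_le [k1 [k2 [_ /hf [n Ln [q ->]] ->]]].
  by exists n => //; exists (k1 *m q); rewrite mulmA.
move=> h Lh; have [n hn] := Lm h Lh; rewrite hn in Lh *.
move=> k; rewrite msupp_mon in_fset1 => /eqP ->.
by exists n => //; exists mone; rewrite mul1m.
Qed.

End Malg.

(** * The map [tau] induced by [sigma] on monomials *)

Section Endomorphism.

Variables (K : fieldType) (sigma : {lrmorphism polyring K -> polyring K}).
Local Notation mon := (pterm (1 : K)).

Variable tau : {cmonom nat} -> {cmonom nat}.
Hypothesis sigma_inj : injective sigma.
Hypothesis sigmaE : forall m, sigma (mon m) = mon (tau m).

Implicit Types (f g : polyring K) (m n u : {cmonom nat}).

Lemma sigma_pterm (c : K) m : sigma (pterm c m) = pterm c (tau m).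
Proof.
have ptermZ n : pterm c n = c *: mon n.
  by apply/malgP => k; rewrite [RHS]mcoeffZ 2!mcoeff_pterm mulrnAr mulr1.
by rewrite ptermZ linearZ /= sigmaE -ptermZ.
Qed.

Lemma tau_inj : injective tau.
Proof.
move=> m n tmn; apply: (@mon_inj K); apply: sigma_inj.
by rewrite sigmaE tmn -sigmaE.
Qed.

Lemma tauM : {morph tau : m n / m *m n}.
Proof.
move=> m n; apply: (@mon_inj K) => /=.
have e x y : mon (x *m y) = mon x * mon y :> polyring K.
  by rewrite ptermM mulr1.
by rewrite -sigmaE e rmorphM /= sigmaE (sigmaE n) -e.
Qed.

Lemma tau1 : tau mone = mone.
Proof.
apply: (@mon_inj K) => /=.
have e1 : mon mone = 1 by rewrite ptermE.
by rewrite -sigmaE e1 rmorph1.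
Qed.

Lemma iter_sigma_mon k m : iter k sigma (mon m) = mon (iter k tau m).
Proof. by elim: k => //= k ->; exact: sigmaE. Qed.

Lemma iter_tau_inj k : injective (iter k tau).
Proof. by elim: k => //= k IHk m n /tau_inj /IHk. Qed.

Lemma sigma_expand f : sigma f = \sum_(k <- msupp f) pterm f@_k (tau k).
Proof.
rewrite {1}(pterm_expand f) raddf_sum; apply: eq_bigr => k _; exact: sigma_pterm.
Qed.

Lemma mem_sigma f n : n \in msupp (sigma f) ->
  exists2 m, m \in msupp f & n = tau m.
Proof.
rewrite -mcoeff_neq0 => nf; apply: contrapT => h; case/eqP: nf.
rewrite sigma_expand raddf_sum big_seq big1 //= => m mf.
by rewrite mcoeff_pterm; case: eqP => // mn; case: h; exists m.
Qed.

(** As [tau] is injective, no other monomial of [f] can cancel the image of [m]. *)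
Lemma mem_sigma_tau f m : m \in msupp f -> tau m \in msupp (sigma f).
Proof.
move=> mf; rewrite -mcoeff_neq0 sigma_expand raddf_sum /=.
rewrite (big_fsetD1 m) //= mcoeff_pterm eqxx mulr1n big1_fset ?addr0 ?mcoeff_neq0 //.
move=> k; rewrite in_fsetD1 => /andP[km _] _; rewrite mcoeff_pterm.
by rewrite (inj_eq tau_inj) (negPf km).
Qed.

Lemma mem_iter_sigma k f n : n \in msupp (iter k sigma f) ->
  exists2 m, m \in msupp f & n = iter k tau m.
Proof.
elim: k n => [|k IHk] n /=; first by exists n.
by move=> /mem_sigma [m /IHk [m' m'f ->] ->]; exists m'.
Qed.

Lemma mem_iter_sigma_tau k f m :
  m \in msupp f -> iter k tau m \in msupp (iter k sigma f).
Proof. by move=> mf; elim: k => //= k; exact: mem_sigma_tau. Qed.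

Lemma of_smonomE (u : smonom) :
  of_smonom sigma u = skew_term sigma (mon u.1) u.2.
Proof. by rewrite ptermE. Qed.

Lemma of_smonomM m i n j :
  of_smonom sigma (m, i) * of_smonom sigma (n, j)
  = of_smonom sigma (m *m iter i tau n, i + j)%N.
Proof.
rewrite !of_smonomE /= skew_termM iter_sigma_mon.
by rewrite ptermM mulr1.
Qed.

(** * Weights and low variables *)

Section Weight.

Variable w : {cmonom nat} -> option nat.
Hypothesis hw : weight_function sigma w.

(** Adding 1 commutes with maxima and fixes -oo, so the rule for variables extends to products. *)
Lemma weight_tau m : w (tau m) = omap (addn 1) (w m).
Proof.
elim/cmonom_ind: m => [|i m IHm]; first by rewrite tau1 (weight1 hw).
have sigma_x : sigma (xvar K i) = << tau (ucm i) >>.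
  by have := sigmaE (ucm i); rewrite !ptermE.
rewrite tauM !(weightM hw) IHm (weight_sigma hw sigma_x).
by case: (w (ucm i)) (w m) => [a|] [b|] //=; rewrite addn_maxr.
Qed.

Lemma weight_iter_tau k m : w (iter k tau m) = omap (addn k) (w m).
Proof.
elim: k => [|k IHk] /=; first by case: (w m).
by rewrite weight_tau IHk; case: (w m).
Qed.

Lemma wcomp_sigma i f :
  wcomp w (Some i) f -> wcomp w (Some i.+1) (sigma f).
Proof. by move=> fi m /mem_sigma [n /fi ni ->]; rewrite weight_tau ni. Qed.

Definition wle (a : option nat) (n : nat) : bool :=
  if a is Some k then (k <= n)%N else true.

Lemma wle_max a b (n : nat) : wle (wmax a b) n = wle a n && wle b n.
Proof. by case: a b => [a|] [b|] //=; rewrite ?geq_max ?andbT. Qed.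

Definition low (n : nat) : pred nat := fun i => wle (w (ucm i)) n.

Lemma wle_low (n : nat) m : wle (w (mrestr (low n) m)) n.
Proof.
elim/cmonom_ind: m => [|i m IHm]; first by rewrite mrestr1 (weight1 hw).
rewrite mrestrM mrestrU; case: ifP => [hi|_]; last by rewrite mul1m.
by rewrite (weightM hw) wle_max IHm andbT.
Qed.

Lemma low_id (n : nat) m : wle (w m) n -> mrestr (low n) m = m.
Proof.
move=> mn; apply/eqP/cmP => i; rewrite mrestrE; case: ifP => // /negP lo_i.
(* A variable with nonzero exponent divides [m], so its weight is at most that of [m]. *)
apply/esym/eqP; apply: contrapT => /negP /cmonom_factor [m' mE].
by apply: lo_i; move: mn; rewrite mE (weightM hw) wle_max => /andP[].
Qed.

End Weight.

(** * The monomial ordering and leading monomials *)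

Section Order.

Variable lt : smonom -> smonom -> Prop.
Hypothesis hlt : monomial_ordering sigma lt.

Lemma lt_irr (u : smonom) : ~ lt u u.
Proof.
by elim/(well_founded_ind (mo_wf hlt)): u => u IHu uu; exact: (IHu u uu).
Qed.

Lemma lt_asym (u v : smonom) : lt u v -> ~ lt v u.
Proof. by move=> uv vu; exact: lt_irr (mo_trans hlt uv vu). Qed.

(** These are the products of v s^i and v' s^j by p s^a on the left and q s^b on the right, with all
    powers of s moved to the right. *)
Lemma lt_mul (p q v v' : {cmonom nat}) a b i j : lt (v, i) (v', j) ->
  lt (p *m iter a tau v *m iter (a + i) tau q, a + i + b)%N
     (p *m iter a tau v' *m iter (a + j) tau q, a + j + b)%N.
Proof.
move=> vv'; apply: (mo_mul hlt (p := (p, a)) (q := (q, b)) vv').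
  by rewrite !of_smonomM.
by rewrite !of_smonomM.
Qed.

Lemma iter_tau1 k : iter k tau mone = mone.
Proof. by elim: k => //= k ->; exact: tau1. Qed.

Lemma lt_shift m n i : lt (m, 0%N) (n, 0%N) -> lt (m, i) (n, i).
Proof.
move/(@lt_mul mone mone m n 0 i).
by rewrite !iter_tau1 /= !mul1m !mulm1 !add0n.
Qed.

Lemma lt_unshift m n i : lt (m, i) (n, i) -> lt (m, 0%N) (n, 0%N).
Proof.
case: (mo_total hlt (m, 0%N) (n, 0%N)) => // [[->] /lt_irr//|].
by move=> /lt_shift /lt_asym /[apply].
Qed.

(** Left multiplication by s^k produces the images under [tau] together with a common right factor
    s^k, which cancels. *)
Lemma lt_iter_tau k m n :
  lt (m, 0%N) (n, 0%N) -> lt (iter k tau m, 0%N) (iter k tau n, 0%N).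
Proof.
move=> /(@lt_mul mone mone m n k 0).
by rewrite !iter_tau1 /= !mul1m !mulm1 !addn0; exact: lt_unshift.
Qed.

Lemma lt_mulI u m n :
  lt (m *m u, 0%N) (n *m u, 0%N) -> lt (m, 0%N) (n, 0%N).
Proof.
case: (mo_total hlt (m, 0%N) (n, 0%N)) => // [[->] /lt_irr//|].
move=> /(@lt_mul mone u n m 0 0) /=.
by rewrite !mul1m !addn0 => /lt_asym /[apply].
Qed.

(** The iterate of [tau] maps the support of [g] onto that of the image, injectively and in
    increasing order. *)
Lemma is_lm_iter_sigma k g n : is_lm lt (iter k sigma g) n ->
  exists2 m, is_lm lt g m & n = iter k tau m.
Proof.
case=> /mem_iter_sigma [m mg ->] max_m; exists m => //; split=> // m' m'g m'm.
case: (mo_total hlt (m', 0%N) (m, 0%N)) => // [[/m'm] //|].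
move=> /(lt_iter_tau k) /lt_asym; case; apply: max_m.
  exact: mem_iter_sigma_tau.
by move/iter_tau_inj.
Qed.

(** All monomials of [f] that contribute to this coordinate share the high part of [m], and a common
    factor cancels from comparisons. *)
Lemma is_lm_slice B f m : is_lm lt f m ->
  is_lm lt (slice B (mrestr (predC B) m) f) (mrestr B m).
Proof.
case=> mf max_m; split; first exact: mem_slice_restr.
move=> n /mem_slice [m' m'f [hi_m' <-]] lo_ne.
apply: (@lt_mulI (mrestr (predC B) m)).
rewrite mrestrK -hi_m' mrestrK; apply: max_m => // m'm.
by apply: lo_ne; rewrite m'm.
Qed.

Lemma is_slm_skew_term g m i :
  is_lm lt g m -> is_slm lt (skew_term sigma g i) (m, i).
Proof.
case=> mg max_m; split=> [|[n j]]; rewrite /ssupp /= skew_coef_term.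
  by rewrite eqxx.
case: eqP => [->|_]; last by rewrite msupp0.
move=> ng nm; apply: lt_shift; apply: max_m => // n_m.
by apply: nm; rewrite n_m.
Qed.

End Order.

End Endomorphism.

(** * Leading monomials of the skew analogue *)

Theorem proposition5p18 (K : fieldType)
    (sigma : {lrmorphism polyring K -> polyring K}) (hsigma : monomial_endo sigma)
    (w : {cmonom nat} -> option nat) (hw : weight_function sigma w)
    (lt : smonom -> smonom -> Prop) (hlt : monomial_ordering sigma lt)
    (I : set (polyring K)) (hI : is_ideal I) (hIproper : I `<` setT)
    (hIgraded : wgraded w I) (hIsigma : sigma_invariant sigma I)
    (G : nat -> set (polyring K))
    (hG : forall i, G i `<=` I `&` wcomp w (Some i))
    (hGbasis : groebner_sigma_basis sigma lt (\bigcup_i G i) I) :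
  (forall f, skew_family sigma G f -> shomogeneous f)
  /\ groebner_basis lt (skew_family sigma G) (skew_analogue sigma w I).
Proof.
have sub_family : skew_family sigma G `<=`
    skew_family sigma (fun i => I `&` wcomp w (Some i)).
  by move=> h [i [f /hG If ->]]; exists i; exists f.
split=> [h [i [f _ ->]]|]; first by exists i, f.
split; first exact: subset_trans sub_family (@sub_ideal_gen _ _).
apply/seteqP; split.
  apply: ideal_genS => h [f [u [Gf lmf ->]]]; exists f, u; split => //.
  by apply: sub_ideal_gen; exact: sub_family.
apply: ideal_gen_min; first exact: ideal_gen_is_ideal.
move=> h [f [[m n] [Jf [mf max_m] ->]]].
have [tau sigmaE] : exists tau : {cmonom nat} -> {cmonom nat},
    forall m, sigma (pterm (1 : K) m) = pterm (1 : K) (tau m).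
  have /choice[tau tauE] := endo_monom hsigma.
  by exists tau => k; have := tauE k; rewrite !ptermE.
have sigma_inj := endo_inj hsigma.
pose A k := ideal_gen (\bigcup_(j in [set j | (j <= k)%N])
  (I `&` wcomp w (Some j))).
have Jcoef : forall k, A k (skew_coef f k).
  pose J := [set h : skewpoly sigma | forall k, A k (skew_coef h k)].
  suff : skew_analogue sigma w I `<=` J by exact.
  apply: ideal_gen_min.
    apply: skew_filtration_ideal => [k|k|k g].
    - exact: ideal_gen_is_ideal.
    - by apply: ideal_genS; apply: bigcup_subset => j /= /leqW.
    (* The preimage of an ideal under [sigma] is an ideal, so generators suffice; on these [sigma]
       raises the weight by 1. *)
    apply: (@ideal_gen_min _ _ [set g | A k.+1 (sigma g)]).
      have [A0 AD AM] := @ideal_gen_is_ideal (polyring K)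
        (\bigcup_(j in [set j | (j <= k.+1)%N]) (I `&` wcomp w (Some j))).
      split=> [|x y|a x b] /=; first by rewrite rmorph0.
        by rewrite rmorphD; exact: AD.
      by rewrite !rmorphM; exact: AM.
    move=> x [j /= jk [Ix xj]]; apply: sub_ideal_gen; exists j.+1 => //=.
    by split; [apply: hIsigma; exists x|exact: (wcomp_sigma sigmaE hw xj)].
  move=> _ [i [g Ig ->]] k; rewrite skew_coef_term.
  case: eqP => [->|_]; first by apply: sub_ideal_gen; exists i => //=.
  by case: (@ideal_gen_is_ideal (polyring K)
    (\bigcup_(j in [set j | (j <= k)%N]) (I `&` wcomp w (Some j)))).
have lm_coef : is_lm lt (skew_coef f n) m.
  split=> // k kf km; apply: (lt_unshift sigmaE hlt (i := n)).
  by apply: max_m => // -[/km].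
pose B := low w n; pose hi := mrestr (predC B) m; pose lo := mrestr B m.
have slice_I : I (slice B hi (skew_coef f n)).
  (* A generator of [A n] involves low variables only: its coordinate at 1 is itself and the others
     vanish. *)
  suff sub : A n `<=` [set g | forall u, I (slice B u g)] by exact: sub.
  apply: (ideal_gen_min (slice_ideal B hI)).
  move=> x [j /= jn [Ix xj]] u; rewrite slice_id => [|k /xj kj].
    by case: eqP => // _; case: hI.
  by apply: (low_id hw); rewrite kj.
have lo_lm : ideal_gen (lm_set lt (sigma_orbit sigma (\bigcup_i G i)))
    (pterm (1 : K) lo).
  case: hGbasis => _ ->; apply: sub_ideal_gen.
  exists (slice B hi (skew_coef f n)), lo; split => //; last by rewrite ptermE.
  exact: (is_lm_slice sigmaE hlt).
have [|n0 [g [n1 [[k [g0 [i _ Gg0] ->]] lm_g n01]]] [q lo_q]] :=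
    monomial_ideal_mem _ lo_lm.
  by move=> _ [? [k [_ _ ->]]]; exists k; rewrite ptermE.
have {n01 n1 lm_g} lm_g : is_lm lt (iter k sigma g0) n0.
  suff -> : n0 = n1 by [].
  by apply: (@mon_inj K); rewrite n01 ptermE.
have [m0 lm_g0 n0E] := is_lm_iter_sigma sigma_inj sigmaE hlt lm_g.
have m0i : w m0 = Some i by have [_] := hG _ _ Gg0; apply; case: lm_g0.
(* The weight of [lo] is at most [n], and its divisor [n0] has weight [k + i]. *)
have kin : (k + i <= n)%N.
  have := wle_low hw n m; rewrite -/B -/lo lo_q n0E (weightM hw).
  by rewrite wle_max (weight_iter_tau sigmaE hw) m0i => /andP[].
(* Moving s^k past [m0] turns it into [n0], and [hi], [q] and [n0] multiply to [m]; the last factor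
   supplies the missing power of s. *)
have -> : of_smonom sigma (m, n) = of_smonom sigma (hi *m q, k)
    * of_smonom sigma (m0, i) * of_smonom sigma (mone, n - (k + i))%N.
  rewrite 2!(of_smonomM sigmaE) (subnKC kin) (iter_tau1 sigmaE) mulm1.
  by rewrite -mulmA -n0E -lo_q mulmC mrestrK.
have [_ _] := @ideal_gen_is_ideal _ (slm_set lt (skew_family sigma G)); apply.
apply: sub_ideal_gen; exists (skew_term sigma g0 i), (m0, i); split => //.
  by exists i; exists g0.
exact: (is_slm_skew_term sigmaE hlt).
Qed.
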